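(* Let $n\ge 1$ be an integer, let $\lambda_1,\dots,\lambda_n\in\mathbb{R}$, and let $w_1,\dots,w_n>0$ with $\sum_{i=1}^n w_i=1$. Let $k_\sigma:\mathbb{R}\to[0,\infty)$ be a smoothing kernel (a probability density) which is supported on the whole real line, is symmetric, i.e. $k_\sigma(-x)=k_\sigma(x)$, and has finite moments of all orders. Let $\tilde p(\lambda)=\sum_{i=1}^n w_i k_\sigma(\lambda-\lambda_i)$ be the kernel-smoothed version of the Dirac mixture $\sum_{i=1}^n w_i\,\delta(\lambda-\lambda_i)$. Then for every integer $m\ge 1$, the $m$-th moment of the smoothed density differs from the $m$-th moment of the Dirac mixture as follows: $$\int_{\mathbb{R}}\lambda^m\,\tilde p(\lambda)\,d\lambda=\sum_{i=1}^n w_i\lambda_i^m+\sum_{i=1}^n w_i\sum_{j=1}^{r/2}\binom{m}{2j}\,\mathbb{E}_{k_\sigma(\lambda)}(\lambda^{2j})\,\lambda_i^{m-2j},$$ where $r=m$ if $m$ is even and $r=m-1$ if $m$ is odd.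
   Context: $\mathbb{E}_{k_\sigma(\lambda)}(\lambda^{2j})=\int_{\mathbb{R}}x^{2j}k_\sigma(x)\,dx$ denotes the $2j$-th central moment of the kernel (which is centred at $0$ by symmetry). The $m$-th moment of the Dirac mixture $\sum_{i=1}^n w_i\delta(\lambda-\lambda_i)$ is $\sum_{i=1}^n w_i\lambda_i^m$. Conventions: $\lambda_i^0=1$ (also when $\lambda_i=0$), and an empty sum (the case $r=0$) is $0$. *)

(* Defs.v *)
From HB Require Import structures.
From mathcomp Require Import all_boot all_order all_algebra.
From mathcomp Require Import all_classical all_reals all_analysis.
Import Order.TTheory GRing.Theory Num.Theory.
Import numFieldNormedType.Exports.

Set Implicit Arguments.
Unset Strict Implicit.
Unset Printing Implicit Defensive.

Local Open Scope classical_set_scope.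
Local Open Scope ring_scope.

(* [sk_support] is the topological support, the closure of the non-vanishing
   set.  This is implied both by [forall x, 0 < k x] and by full support of
   the probability measure with density [k]. *)
Record smoothing_kernel (R : realType) (k : R -> R) : Prop := SmoothingKernel {
  sk_measurable : measurable_fun [set: R] k ;
  sk_ge0 : forall x, 0 <= k x ;
  sk_int1 : (\int[@lebesgue_measure R]_x (k x)%:E = 1)%E ;
  sk_support : closure [set x | k x != 0] = [set: R] ;
  sk_sym : forall x, k (- x) = k x ;
  sk_moments : forall j : nat,
    (@lebesgue_measure R).-integrable [set: R] (fun x => (x ^+ j * k x)%:E)
}.

(* Extended-real valued, because an arbitrary [p] need not have a finite
   moment.  As [+oo - oo = -oo] in [\bar R], a finite value for a measurable
   [p] means that the integral converges absolutely. *)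
Definition moment (R : realType) (p : R -> R) (m : nat) : \bar R :=
  (\int[@lebesgue_measure R]_x (x ^+ m * p x)%:E)%E.

Definition smoothed_density (R : realType) (n : nat) (w lambda : 'I_n -> R)
    (k : R -> R) : R -> R :=
  fun x => \sum_(i < n) w i * k (x - lambda i).

Definition even_floor (m : nat) : nat := if odd m then m.-1 else m.

(* Main.v *)
(* By translation invariance of Lebesgue measure, the m-th moment of
   [k (x - a)] is the integral of [(x + a) ^+ m * k x], which the binomial
   formula expands into the moments of [k].  The odd ones vanish by symmetry,
   and the zeroth one, equal to 1, contributes the term [a ^+ m] of the Dirac
   mixture. *)
Require Import Defs.
From HB Require Import structures.
From mathcomp Require Import all_boot all_order all_algebra.
From mathcomp Require Import all_classical all_reals all_analysis.
From mathcomp Require Import measurable_realfun.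
Import Order.TTheory GRing.Theory Num.Theory.
Import numFieldNormedType.Exports.
Local Open Scope classical_set_scope.
Local Open Scope ring_scope.

(** Integrating against [mu] is integrating against its pushforward along [phi]. Integrability is
    assumed on the composed side because that is where the integrand becomes explicit: a sign change
    or a binomial expansion. *)
Lemma integral_lebesgue_preserving (R : realType) (phi : R -> R)
    (f : R -> \bar R) (mu := @lebesgue_measure R) :
  measurable_fun [set: R] phi ->
  (forall A, measurable A ->
    pushforward mu (phi : _ -> measurableTypeR R) A = mu A) ->
  measurable_fun [set: R] f ->
  mu.-integrable [set: R] (fun x => f (phi x)) ->
  mu.-integrable [set: R] f /\
  (\int[mu]_x f x = \int[mu]_x f (phi x))%E.
Proof.
move=> mphi pres mf intf.
have pull (g : R -> \bar R) : measurable_fun [set: R] g ->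
    mu.-integrable [set: R] (fun x => g (phi x)) ->
    (\int[mu]_x g x = \int[mu]_x g (phi x))%E.
  move=> mg intg.
  have := @integral_pushforward _ _ (measurableTypeR R) (measurableTypeR R) _
    _ mphi mu setT g mg intg measurableT.
  rewrite preimage_setT => <-.
  by apply: eq_measure_integral => A mA _; rewrite /= pres.
split; last exact: pull.
(* Applying [pull] to the absolute value of [f] transfers the finiteness of its integral from the
   composed function. *)
apply/integrableP; split=> //.
rewrite (pull (fun x => `|f x|%E)).
- by have /integrableP[] := intf.
- exact: measurableT_comp.
- exact: integrable_abse.
Qed.

(** Lebesgue measure is determined by its values on half-open intervals, and a shift keeps their
    length. *)
Lemma lebesgue_measure_shift (R : realType) (a : R) (A : set R) :
  measurable A ->
  pushforward lebesgue_measure (+%R^~ a : _ -> measurableTypeR R) A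
  = lebesgue_measure A.
Proof.
move=> mA; apply/esym/(@lebesgue_measure_unique R) => //=.
  exact: measurable_funD.
move=> mphi _ [[b c]] _ <-; rewrite /pushforward.
have -> : +%R^~ a @^-1` `]b, c]%classic = `]b - a, c - a]%classic.
  by apply/seteqP; split=> x /=; rewrite !in_itv /= ltrBlDr lerBrDr.
by rewrite !lebesgue_measure_itv /= !lte_fin ltrD2r -!EFinB opprB addrA subrK.
Qed.

Lemma sum_even (V : nmodType) (F : nat -> V) (m : nat) :
  (forall j, odd j -> F j = 0) ->
  \sum_(i < m.+1) F i = F 0%N + \sum_(1 <= j < m./2.+1) F (2 * j)%N.
Proof.
(* The term [F 0] is absorbed as the index 0 of the even sum, so that the induction only ever
   appends a last term: none when [m.+1] is odd, [F m.+1] when it is even. *)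
move=> Fodd; rewrite -[X in X + _]/(F (2 * 0)%N) -big_ltn //.
elim: m => [|m IHm]; first by rewrite big_ord1 big_nat1.
rewrite big_ord_recr IHm /= uphalf_half.
have [om|em] := boolP (odd m); last by rewrite Fodd /= ?addr0 ?em.
rewrite [RHS]big_nat_recr //=; congr (_ + F _).
by rewrite mul2n doubleS -[LHS]odd_double_half /= om !add0n uphalf_half om.
Qed.

Section KernelMoments.
Variables (R : realType) (k : R -> R).
Hypothesis hk : smoothing_kernel k.
Local Notation mu := (@lebesgue_measure R).

Lemma moment_fineK (j : nat) : moment k j = (fine (moment k j))%:E.
Proof.
by rewrite fineK //; apply: integrable_fin_num => //; exact: sk_moments.
Qed.

Lemma moment_odd (j : nat) : odd j -> moment k j = 0%E.
Proof.
move=> oj.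
have fN x : ((- x) ^+ j * k (- x))%:E = (- (x ^+ j * k x)%:E)%E.
  by rewrite exprNn -signr_odd oj expr1 mulN1r (sk_sym hk) mulNr EFinN.
have intM := sk_moments hk j.
have [_] : mu.-integrable [set: R] (fun x => (x ^+ j * k x)%:E) /\
    (moment k j = \int[mu]_x ((- x) ^+ j * k (- x))%:E)%E.
  apply: (@integral_lebesgue_preserving _ -%R) => //.
  - exact: lebesgue_measureN.
  - exact: measurable_int intM.
  - under eq_fun do rewrite fN.
    exact: integrableN.
under eq_integral do rewrite fN.
rewrite integralN ?integrable_add_def // -/(moment k j) moment_fineK.
(* The moment is finite, so the equality with its own opposite can be read in [R], where it says
   that twice the moment is 0. *)
rewrite -EFinN => -[/eqP]; rewrite -addr_eq0 -mulr2n mulrn_eq0 /=.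
by move=> /eqP ->.
Qed.

(** Integrability is part of the conclusion because the integral of the mixture is later split
    component by component. Moments of all parities are still present here. *)
Lemma shifted_moment (a : R) (m : nat) :
  mu.-integrable [set: R] (fun x => (x ^+ m * k (x - a))%:E) /\
  (\int[mu]_x (x ^+ m * k (x - a))%:E =
   (\sum_(i < m.+1) 'C(m, i)%:R * fine (moment k i) * a ^+ (m - i))%:E)%E.
Proof.
have fD x : (((x + a) ^+ m * k (x + a - a))%:E =
    \sum_(i < m.+1) ('C(m, i)%:R * a ^+ (m - i))%:E * (x ^+ i * k x)%:E)%E.
  rewrite addrK addrC exprDn mulr_suml sumEFin; congr EFin.
  by apply: eq_bigr => i _; rewrite -mulr_natl !mulrA.
(* By [fD] this is a finite linear combination of the integrands of the moments of [k]. *)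
have intf : mu.-integrable [set: R]
    (fun x => ((x + a) ^+ m * k (x + a - a))%:E).
  under eq_fun do rewrite fD.
  by apply: integrable_sum => // i _; apply: integrableZl => //; exact: sk_moments.
have mf : measurable_fun [set: R] (fun x : R => (x ^+ m * k (x - a))%:E).
  apply/measurable_EFinP/measurable_funM; first exact: measurable_funX.
  by apply: (measurableT_comp (sk_measurable hk)); exact: measurable_funB.
have [|? ->] := @integral_lebesgue_preserving _ (+%R^~ a) _ _
    (lebesgue_measure_shift R a) mf intf; first exact: measurable_funD.
split=> //; under eq_integral do rewrite fD.
rewrite integral_sum //; last first.
  by move=> i; apply: integrableZl => //; exact: sk_moments.
rewrite -sumEFin; apply: eq_bigr => i _.
rewrite integralZl //; last exact: sk_moments.
by rewrite -/(moment k i) {1}moment_fineK -EFinM mulrAC.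
Qed.

End KernelMoments.

Theorem theorem1 (R : realType) (n : nat) (hn : (1 <= n)%N)
    (lambda w : 'I_n -> R)
    (w_gt0 : forall i, 0 < w i) (w_sum1 : \sum_(i < n) w i = 1)
    (k : R -> R) (hk : smoothing_kernel k)
    (m : nat) (hm : (1 <= m)%N) :
  moment (smoothed_density w lambda k) m =
  (\sum_(i < n) w i * lambda i ^+ m
   + \sum_(i < n) w i *
       \sum_(1 <= j < (even_floor m %/ 2).+1)
         'C(m, 2 * j)%:R * fine (moment k (2 * j))
           * lambda i ^+ (m - 2 * j))%:E.
Proof.
(* For odd [m], both [m] and [m.-1] have the same integer half. *)
have -> : (even_floor m %/ 2 = m./2)%N.
  by rewrite divn2 /even_floor; case: ifP => //; case: m {hm} => //= m /negbTE;
    rewrite uphalf_half => ->.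
have moment0 : fine (moment k 0) = 1.
  rewrite /moment; under eq_integral do rewrite expr0 mul1r.
  by rewrite (sk_int1 hk).
(* With the two sums over [i] merged, the identity can be checked for each component separately. *)
rewrite -big_split /moment /=.
under eq_integral => x _.
  rewrite /smoothed_density mulr_sumr -sumEFin.
  under eq_bigr => i _ do rewrite mulrCA EFinM.
  over.
rewrite integral_sum //; last first.
  by move=> i; apply: integrableZl => //; exact: (shifted_moment R k hk _ m).1.
rewrite -sumEFin; apply: eq_bigr => i _.
have [intf intE] := shifted_moment R k hk (lambda i) m.
rewrite integralZl // intE -EFinM -mulrDr; congr ((_ * _)%:E).
(* [F 0] is the Dirac term [lambda i ^+ m], and [F] vanishes at odd indices with the odd moments of
   [k]. *)
pose F j := 'C(m, j)%:R * fine (moment k j) * lambda i ^+ (m - j).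
rewrite (@sum_even _ F) => [|j oj].
  by rewrite /F bin0 moment0 subn0 !mul1r.
by rewrite /F (moment_odd R k hk) // mulr0 mul0r.
Qed.
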